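(* Let $P$ be an ordered simplicial complex. Then $\Omega_k(P)=C_k(P)$ for every $k\ge 0$, and moreover the regular boundary map satisfies $$\partial_k(v_0\dots v_k)=\sum_{i=0}^k(-1)^i\, v_0\dots\hat{v_i}\dots v_k$$ for every $v_0\dots v_k\in P$ (where in degree $k=0$ the boundary map is zero).
   Context: Fix a field $\mathbb F$. An elementary $k$-path on a set $V$ is a sequence $v_0\dots v_k$ of $k+1$ elements of $V$; it is irregular if $v_i=v_{i+1}$ for some $i$, regular otherwise, and simplicial if all $v_i$ are distinct. $v_0\dots\hat{v_i}\dots v_k$ denotes the path with $v_i$ removed. A path complex on $V$ is a set $P$ of elementary paths containing all singletons and closed under deleting the first or the last vertex of a path; it is regular if all its paths are regular. An ordered simplicial complex on $V$ is a set of simplicial paths containing all singletons and closed under deleting any one vertex; it is a regular path complex. For a regular path complex $P$ on $V$ let $\Lambda_k,\mathcal R_k,\mathcal I_k$ be the free $\mathbb F$-vector spaces on all, all regular, and all irregular elementary $k$-paths on $V$ respectively, and let $C_k(P)\subseteq\mathcal R_k$ be the free vector space on the $k$-paths in $P$. The non-regular boundary map $\partial^{nr}_k:\Lambda_k\to\Lambda_{k-1}$ is the linear map $v_0\dots v_k\mapsto\sum_{i=0}^k(-1)^i v_0\dots\hat{v_i}\dots v_k$ ($k\geq 1$). It satisfies $\partial^{nr}_k(\mathcal I_k)\subseteq\mathcal I_{k-1}$, and so, via $\mathcal R_k\cong\Lambda_k/\mathcal I_k$, induces the regular boundary map $\partial_k:\mathcal R_k\to\mathcal R_{k-1}$ (compute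 the same alternating sum and drop the irregular summands). Chain complexes are non-negatively graded, so $\partial_0=0$. Define $\Omega_k(P)=\{c\in C_k(P) : \partial_k(c)\in C_{k-1}(P)\}$ (with $C_{-1}(P)=0$). *)

(* Defs.v *)
From HB Require Import structures.
From mathcomp Require Import all_boot all_order all_algebra.
From mathcomp Require Import boolp classical_sets.
From mathcomp Require Import finmap monalg zify.

Set Implicit Arguments.
Unset Strict Implicit.
Unset Printing Implicit Defensive.

Import GRing.Theory.
Local Open Scope classical_set_scope.
Local Open Scope ring_scope.

(* The free [F]-vector space on a set [K] is [{malg F[K]}], the finitely
   supported functions [K -> F]; its basis vectors are written [<< x >>]. *)

Section LinearExtension.
Variables (F : fieldType) (K : choiceType) (W : lmodType F) (f : K -> W).

Definition linext (c : {malg F[K]}) : W := \sum_(x <- msupp c) c@_x *: f x.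

Lemma linextEw (d : {fset K}) c :
  {subset msupp c <= d} -> linext c = \sum_(x <- d) c@_x *: f x.
Proof.
move=> /fsubsetP le_cd; rewrite /linext; apply: big_fset_incl le_cd _ => x _.
by move=> /mcoeff_outdom ->; rewrite scale0r.
Qed.

Fact linext_linear : linear linext.
Proof.
move=> a c1 c2.
pose d := (msupp c1 `|` msupp c2 `|` msupp (a *: c1 + c2))%fset.
rewrite !(@linextEw d); try by move=> x x_c; rewrite !inE x_c ?orbT.
rewrite scaler_sumr -big_split; apply: eq_bigr => x _ /=.
by rewrite mcoeffD mcoeffZ scalerDl scalerA.
Qed.

HB.instance Definition _ :=
  GRing.isLinear.Build F {malg F[K]} W *:%R linext linext_linear.

Lemma linextU x : linext << x >> = f x.
Proof.
rewrite (@linextEw [fset x]%fset); last exact/fsubsetP/msuppU_le.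
by rewrite big_seq_fset1 mcoeffUU scale1r.
Qed.

End LinearExtension.

Definition epath (V : choiceType) (k : nat) : choiceType := k.+1.-tuple V.

Section Paths.
Variable V : choiceType.

Definition irregular k (p : epath V k) : bool :=
  [exists i : 'I_k, tnth p (widen_ord (leqnSn k) i) == tnth p (lift ord0 i)].

Definition regular k (p : epath V k) : bool := ~~ irregular p.

Definition simplicial k (p : epath V k) : bool := uniq p.

(* [del i p] is the path [v_0 .. v_{k+1}] with [v_i] removed. *)
Definition del k (i : 'I_k.+2) (p : epath V k.+1) : epath V k :=
  [tuple tnth p (lift i j) | j < k.+1].

Definition rpath (k : nat) : choiceType := {p : epath V k | regular p}.

(* A set of elementary paths is given by its sets of [k]-paths, one for each
   [k]. *)
Record path_complex (P : forall k, set (epath V k)) : Prop := PathComplex {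
  pc_vertex : forall v, P 0%N [tuple v];
  pc_first : forall k (p : epath V k.+1), P k.+1 p -> P k (del ord0 p);
  pc_last : forall k (p : epath V k.+1), P k.+1 p -> P k (del ord_max p)
}.

Record regular_path_complex (P : forall k, set (epath V k)) : Prop :=
  RegularPathComplex {
  rpc_path_complex : path_complex P;
  rpc_regular : forall k (p : epath V k), P k p -> regular p
}.

Record ordered_simplicial_complex (P : forall k, set (epath V k)) : Prop :=
  OrderedSimplicialComplex {
  osc_simplicial : forall k (p : epath V k), P k p -> simplicial p;
  osc_vertex : forall v, P 0%N [tuple v];
  osc_del : forall k (i : 'I_k.+2) (p : epath V k.+1),
    P k.+1 p -> P k (del i p)
}.

Lemma simplicial_regular k (p : epath V k) : simplicial p -> regular p.
Proof.
move=> /tuple_uniqP p_inj; apply/existsPn => i; apply/eqP => /p_inj /(congr1 val).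
by rewrite /= /bump /= => /eqP; rewrite add1n ltn_eqF.
Qed.

Lemma osc_rpc P : ordered_simplicial_complex P -> regular_path_complex P.
Proof.
move=> [P_simp P_vert P_del]; split=> [|k p /P_simp/simplicial_regular //].
by split=> // k p; apply: P_del.
Qed.

(* A path of a regular path complex, as an element of the type of regular
   paths. *)
Definition rpath_of P (hP : regular_path_complex P) k (p : epath V k)
  (Pp : P k p) : rpath k := exist _ p (rpc_regular hP Pp).

End Paths.

Section Chains.
Variables (F : fieldType) (V : choiceType).

Definition Lambda (k : nat) : lmodType F := {malg F[epath V k]}.

Definition Rchain (k : nat) : lmodType F := {malg F[rpath V k]}.

Definition Ichain (k : nat) : set (Lambda k) :=
  [set c : {malg F[epath V k]} | forall p, p \in msupp c -> irregular p].

(* [bdnr k] is the non-regular boundary map in degree [k.+1]. *)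
Definition bdnr (k : nat) : Lambda k.+1 -> Lambda k :=
  linext (fun p : epath V k.+1 =>
    \sum_(i < k.+2) (-1) ^+ i *: (<< del i p >> : Lambda k)).

HB.instance Definition _ k := GRing.Linear.on (@bdnr k).

Definition incl (k : nat) : Rchain k -> Lambda k :=
  linext (fun p : rpath V k => << val p >> : Lambda k).

HB.instance Definition _ k := GRing.Linear.on (@incl k).

(* The projection with kernel [Ichain k], dropping the irregular summands. *)
Definition proj (k : nat) : Lambda k -> Rchain k :=
  linext (fun p : epath V k =>
    if insub p is Some r then << r >> else 0 : Rchain k).

HB.instance Definition _ k := GRing.Linear.on (@proj k).

(* [Rlow k] is the space of regular chains of degree [k - 1], which is zero for
   [k = 0]. *)
Definition Rlow (k : nat) : lmodType F :=
  if k is j.+1 then Rchain j else 'rV[F]_0.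

Definition bd (k : nat) : Rchain k -> Rlow k :=
  match k return Rchain k -> Rlow k with
  | 0%N => fun=> 0
  | j.+1 => fun c => proj (bdnr (incl c))
  end.

Fact bd_linear k : linear (@bd k).
Proof. by case: k => [|k] a c d /=; rewrite ?linearP ?addr0 ?scaler0. Qed.

HB.instance Definition _ k :=
  GRing.isLinear.Build F (Rchain k) (Rlow k) *:%R (@bd k) (@bd_linear k).

Lemma bdnrU k (p : epath V k.+1) :
  @bdnr k << p >> = \sum_(i < k.+2) (-1) ^+ i *: (<< del i p >> : Lambda k).
Proof. exact: linextU. Qed.

Lemma inclU k (p : rpath V k) : @incl k << p >> = << val p >>.
Proof. exact: linextU. Qed.

Lemma projU k (p : epath V k) :
  @proj k << p >> = if insub p is Some r then << r >> else 0 : Rchain k.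
Proof. exact: linextU. Qed.

Variable P : forall k, set (epath V k).

Definition Cchain (k : nat) : set (Rchain k) :=
  [set c : {malg F[rpath V k]} | forall p, p \in msupp c -> P (val p)].

Definition Clow (k : nat) : set (Rlow k) :=
  match k return set (Rlow k) with
  | 0%N => [set 0]
  | j.+1 => @Cchain j
  end.

Definition Omega (k : nat) : set (Rchain k) :=
  [set c | Cchain c /\ Clow (bd c)].

End Chains.

Arguments Cchain F {V} P k.
Arguments Clow F {V} P k.
Arguments Omega F {V} P k.

(* [bd] is the map induced by [bdnr] on the quotients [Lambda k / Ichain k],
   which [proj] identifies with [Rchain k]: this is the content of [proj_eq0],
   [inclK] and [bd_proj]. *)
Section InducedMap.
Variables (F : fieldType) (V : choiceType).

Lemma malgUZ (K : choiceType) (a : F) (x : K) :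
  << a *g x >> = a *: << x >> :> {malg F[K]}.
Proof. by apply/malgP => y; rewrite mcoeffZ !mcoeffU mulrnAr mulr1. Qed.

Lemma linear_malg_eq (K : choiceType) (W : lmodType F)
    (f g : {linear {malg F[K]} -> W}) :
  (forall x, f << x >> = g << x >>) -> f =1 g.
Proof.
move=> fg c; rewrite (monalgE c) !linear_sum; apply: eq_bigr => x _.
by rewrite malgUZ !linearZ fg.
Qed.

Lemma proj_irregular k (p : epath V k) :
  irregular p -> @proj F V k << p >> = 0.
Proof. by move=> pI; rewrite projU insubF // /regular pI. Qed.

Lemma proj_regular k (p : rpath V k) : @proj F V k << val p >> = << p >>.
Proof. by rewrite projU valK. Qed.

Lemma inclK k : cancel (@incl F V k) (@proj F V k).
Proof.
apply: (@linear_malg_eq _ _ (@proj F V k \o @incl F V k) idfun) => p /=.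
by rewrite inclU proj_regular.
Qed.

Lemma mcoeff_proj k (c : {malg F[epath V k]}) (p : rpath V k) :
  (@proj F V k c : {malg F[rpath V k]})@_p = c@_(val p).
Proof.
rewrite [c in LHS]monalgE linear_sum raddf_sum /=.
rewrite [c in RHS]monalgE raddf_sum /=; apply: eq_bigr => q _.
rewrite malgUZ linearZ /= [LHS]mcoeffZ mcoeffZ; congr (_ * _).
have [qI|qR] := boolP (irregular q).
  rewrite proj_irregular // mcoeff0 mcoeffU; case: eqP => // qp.
  by have : regular (sval p) := svalP p; rewrite -qp /regular qI.
have -> : q = val (Sub q qR : rpath V k) by rewrite SubK.
by rewrite proj_regular !mcoeffU (inj_eq val_inj).
Qed.

Lemma proj_eq0 k (c : Lambda F V k) : @proj F V k c = 0 <-> Ichain c.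
Proof.
split=> [pc0 p|cI].
  rewrite -mcoeff_neq0; apply: contraNT => pR.
  have := mcoeff_proj c (Sub p pR : rpath V k).
  by rewrite pc0 mcoeff0 SubK => <-.
apply/malgP => p; rewrite mcoeff_proj mcoeff0; apply/eqP.
by rewrite mcoeff_eq0; apply: contra (valP p) => /cI.
Qed.

Lemma irregularP k (p : epath V k) :
  reflect (exists i j : 'I_k.+1, j = i.+1 :> nat /\ tnth p i = tnth p j)
    (irregular p).
Proof.
apply: (iffP existsP) => [[i /eqP pi]|[i [j [ji pij]]]].
  by exists (widen_ord (leqnSn k) i), (lift ord0 i).
have ik : (i < k)%N by rewrite -ltnS -ji.
exists (Ordinal ik); apply/eqP; rewrite (_ : widen_ord _ _ = i); last exact: val_inj.
by rewrite (_ : lift _ _ = j) //; apply: val_inj; rewrite /= /bump add1n ji.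
Qed.

Lemma tnth_del k (l : 'I_k.+2) (p : epath V k.+1) j :
  tnth (del l p) j = tnth p (lift l j).
Proof. by rewrite tnth_mktuple. Qed.

Lemma big_cancel2 (I : finType) (W : zmodType) (f : I -> W) i j :
  j != i -> f i + f j = 0 -> (forall l, l != i -> l != j -> f l = 0) ->
  \sum_l f l = 0.
Proof.
move=> ji fij f0; rewrite (bigD1 i) // (bigD1 j) //= addrA fij add0r.
by apply: big1 => l /andP [li lj]; apply: f0.
Qed.

Lemma proj_bdnr_irregular k (p : epath V k.+1) :
  irregular p -> @proj F V k (@bdnr F V k << p >>) = 0.
Proof.
move=> /irregularP [i [j [ji pij]]].
have dij : del j p = del i p.
  apply: eq_from_tnth => m; rewrite !tnth_del.
  have [mi|mi] := eqVneq (m : nat) i.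
    have -> : lift j m = i by apply: val_inj; rewrite /= /bump ji mi ltnn.
    by rewrite pij; congr tnth; apply: val_inj; rewrite /= /bump ji mi leqnn.
  congr tnth; apply: val_inj; rewrite /= /bump ji.
  by rewrite [(i <= m)%N]leq_eqVlt eq_sym (negbTE mi).
have dI l : l != i -> l != j -> irregular (del l p).
  move=> li lj; apply/irregularP.
  have [m mi] : exists m, lift l m = i.
    by case: (unliftP l i) li => [m ->|->]; [exists m | rewrite eqxx].
  have [n nj] : exists n, lift l n = j.
    by case: (unliftP l j) lj => [n ->|->]; [exists n | rewrite eqxx].
  exists m, n; split; last by rewrite !tnth_del mi nj.
  move: ji li lj; rewrite -mi -nj -!val_eqE /= /bump.
  by case: leqP; case: leqP; lia.
have ne_ji : j != i by rewrite -val_eqE /= ji gtn_eqF.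
rewrite bdnrU linear_sum; apply: (big_cancel2 ne_ji) => [|l li lj].
  by rewrite dij ji exprS mulN1r scaleNr linearN; apply: subrr.
rewrite linearZ /= (proj_irregular (dI _ li lj)); exact: scaler0.
Qed.

Lemma bd_proj k (c : Lambda F V k.+1) :
  @bd F V k.+1 (@proj F V k.+1 c) = @proj F V k (@bdnr F V k c).
Proof.
apply: (@linear_malg_eq _ _ (@bd F V k.+1 \o @proj F V k.+1)
  (@proj F V k \o @bdnr F V k)) => p /=.
have [pI|pR] := boolP (irregular p).
  by rewrite (proj_irregular pI) (proj_bdnr_irregular pI) !linear0.
have -> : p = val (Sub p pR : rpath V k.+1) by rewrite SubK.
by rewrite proj_regular inclU.
Qed.

End InducedMap.

(* Main.v *)
Require Import Defs.
From HB Require Import structures.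
From mathcomp Require Import all_boot all_order all_algebra.
From mathcomp Require Import boolp classical_sets.
From mathcomp Require Import finmap monalg.
Set Implicit Arguments.
Unset Strict Implicit.
Unset Printing Implicit Defensive.
Import GRing.Theory.
Local Open Scope classical_set_scope.
Local Open Scope ring_scope.

(** The regular boundary of a path drops exactly those faces that are irregular,
and a chain of [P] fails to lie in [Omega F P k] only when some face of one of
its paths leaves [P]. An ordered simplicial complex is closed under all
deletions, not only those of end vertices, so both phenomena are absent at
once: every face of a path of [P] lies in [P], hence has distinct vertices,
hence is regular. The first consequence is [bd_Cchain], which gives
[Omega F P k = Cchain F P k]; the second is [incl_bdU], which gives the formula
for the boundary. *)

Lemma incl_proj_regular (F : fieldType) (V : choiceType) k (p : epath V k) :
  regular p -> incl (proj << p >>) = << p >> :> Lambda F V k.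
Proof.
move=> p_reg; have -> : p = val (Sub p p_reg : rpath V k) by rewrite SubK.
by rewrite proj_regular inclU.
Qed.

(** When all faces are regular the projection that defines [bd] discards
nothing. *)
Lemma incl_bdU (F : fieldType) (V : choiceType) k (p : rpath V k.+1) :
  (forall i, regular (del i (val p))) ->
  incl (bd (<< p >> : Rchain F V k.+1)) =
  \sum_(i < k.+2) (-1) ^+ i *: (<< del i (val p) >> : Lambda F V k).
Proof.
move=> del_reg; rewrite /bd inclU bdnrU.
rewrite (linear_sum (@proj F V k)) (linear_sum (@incl F V k)).
apply: eq_bigr => i _.
by rewrite !linearZ /= incl_proj_regular.
Qed.

(** A path outside [P] is not a face of any path in the support of a chain of
[P], so its coefficient in the boundary vanishes. The coefficients are read
off through [mcoeff_proj] in the space of all paths, where regular and irregular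
faces are treated alike. *)
Lemma bd_Cchain (F : fieldType) (V : choiceType) (P : forall k, set (epath V k))
    k (c : Rchain F V k.+1) :
  (forall (i : 'I_k.+2) (p : epath V k.+1), P k.+1 p -> P k (del i p)) ->
  Cchain F P k.+1 c -> Cchain F P k (bd c).
Proof.
move=> P_del c_P q q_supp; apply: contrapT => nPq.
move: q_supp; rewrite -mcoeff_neq0 => /eqP; apply.
rewrite mcoeff_proj /incl {1}/linext (linear_sum (@bdnr F V k)) raddf_sum.
rewrite big_seq; apply: big1 => p /c_P Pp.
rewrite linearZ /= bdnrU [LHS]mcoeffZ raddf_sum /=.
rewrite big1 ?mulr0 // => i _; rewrite [LHS]mcoeffZ mcoeffU.
case: eqP => [del_q|_]; last by rewrite mulr0.
by case: nPq; rewrite -[val q]del_q; apply: P_del.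
Qed.

Theorem lemma2p24 (F : fieldType) (V : choiceType)
    (P : forall k, set (epath V k)) (hP : ordered_simplicial_complex P) :
  (forall k, Omega F P k = Cchain F P k) /\
  (forall (p : epath V 0) (Pp : P 0%N p),
     bd (<< rpath_of (osc_rpc hP) Pp >> : Rchain F V 0) = 0) /\
  (forall k (p : epath V k.+1) (Pp : P k.+1 p),
     incl (bd (<< rpath_of (osc_rpc hP) Pp >> : Rchain F V k.+1)) =
     \sum_(i < k.+2) (-1) ^+ i *: (<< del i p >> : Lambda F V k)).
Proof.
have P_del := osc_del hP.
split=> [k|]; last split=> // k p Pp.
  apply/seteqP; split=> [c []//|c c_P]; split=> //.
  by case: k c c_P => [//|k] c; apply: bd_Cchain => i p; apply: P_del.
apply: incl_bdU => i; apply: simplicial_regular.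
exact: (osc_simplicial hP) (P_del _ _ _ Pp).
Qed.
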